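(* The number of $1$-nice $n$-dimensional unique sink orientations is $n^{\Theta(2^n)}$.
   Context: Let $Q^n = 2^{[n]}$ be the vertex set of the $n$-cube, with $u,v$ adjacent iff $|u\oplus v|=1$; faces are $F_{J,v}=\{u : v\oplus u\subseteq J\}$ for $J\subseteq[n]$. A unique sink orientation (USO) is an orientation of the cube's edges such that every nonempty face has a unique sink (vertex with no outgoing edges within the face). The outmap $s_\psi(v)$ is the set of coordinates $j$ such that the edge $\{v,v\oplus\{j\}\}$ is directed away from $v$; the global sink is the vertex $t$ with $s_\psi(t)=\emptyset$. Let $d(v,u)$ be the length of a shortest directed path from $v$ to $u$ ($\infty$ if none). The reachmap is $r_\psi(v)=s_\psi(v)\cup\{j : \exists u \text{ reachable from } v \text{ by a directed path with } j\in s_\psi(u)\}$. A vertex $v$ is $i$-covered by $u$ if $d(v,u)\le i$ and $r_\psi(u)\subsetneq r_\psi(v)$; $\psi$ is $i$-nice if every vertex other than the global sink is $i$-covered by some vertex. *)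

(* Defs.v *)
From mathcomp Require Import all_boot.
Set Implicit Arguments. Unset Strict Implicit. Unset Printing Implicit Defensive.

(* Vertices of Q^n: subsets of [n] = 'I_n.
   An orientation is given by its outmap s : vertex -> set of outgoing
   coordinates. *)
Definition vtx (n : nat) := {set 'I_n}.
Definition outmap (n : nat) := {ffun {set 'I_n} -> {set 'I_n}}.

Definition symdiff (n : nat) (A B : {set 'I_n}) : {set 'I_n} :=
  (A :\: B) :|: (B :\: A).

Definition is_orientation (n : nat) (s : outmap n) : bool :=
  [forall v : {set 'I_n}, forall j : 'I_n,
     (j \in s v) == (j \notin s (symdiff v [set j]))].

Definition face (n : nat) (J v : {set 'I_n}) : {set {set 'I_n}} :=
  [set u | symdiff v u \subset J].

(* unique sink orientation: every face (all faces are nonempty) has exactly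
   one vertex with no outgoing edge inside the face (edges inside F_{J,v}
   are exactly those in directions j \in J). *)
Definition is_USO (n : nat) (s : outmap n) : bool :=
  is_orientation s &&
  [forall J : {set 'I_n}, forall v : {set 'I_n},
     #|[set u in face J v | s u :&: J == set0]| == 1].

Definition dedge (n : nat) (s : outmap n) : rel {set 'I_n} :=
  fun v w => [exists j : 'I_n, (j \in s v) && (w == symdiff v [set j])].

Fixpoint dist_le (n : nat) (s : outmap n) (i : nat) (v u : {set 'I_n}) : bool :=
  match i with
  | 0 => u == v
  | i'.+1 => (u == v) || [exists w, dedge s v w && dist_le s i' w u]
  end.

Definition reachmap (n : nat) (s : outmap n) (v : {set 'I_n}) : {set 'I_n} :=
  s v :|: \bigcup_(u | connect (dedge s) v u) s u.

Definition is_global_sink (n : nat) (s : outmap n) (t : {set 'I_n}) : bool :=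
  s t == set0.

Definition covered (n : nat) (s : outmap n) (i : nat) (v u : {set 'I_n}) : bool :=
  dist_le s i v u && (reachmap s u \proper reachmap s v).

Definition is_nice (n : nat) (s : outmap n) (i : nat) : bool :=
  [forall v : {set 'I_n}, ~~ is_global_sink s v ==>
     [exists u : {set 'I_n}, covered s i v u]].

Definition nice_USO_count (n : nat) : nat :=
  #|[pred s : outmap n | is_USO s && is_nice s 1]|.

(* Main.v *)
(* Upper bound: list the vertices by increasing cardinality and reveal at each
   vertex v the orientation of the edges going down from v. In every 2-face
   below v, spanned by directions i, j, one of the two pairs of parallel edges
   must agree, so the edges revealed earlier exclude one of the four patterns
   on {i, j}. The possible down-outmaps at v therefore shatter no pair, there
   are at most |v| + 1 of them, and all in all at most (n + 1)^(2^n) USOs.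

   Lower bound: fix a direction l, orient all edges downwards, and reverse a
   matching M contained in the facet of the vertices containing l. The result
   is a USO. It is 1-nice because a vertex containing l covers itself by
   dropping l for good, while on the opposite facet the reachmap of v is v.
   Sequentially choosing 2^(n-5) disjoint edges of the facet leaves at every
   step a constant fraction of its edges available, which yields at least
   n^(2^(n-5)) matchings. *)

Require Import Defs.
From Stdlib Require Import Reals Lra Lia.
From mathcomp Require all_boot zify.
Open Scope R_scope.

Section Cube.
Import all_boot zify.
Set Implicit Arguments.
Unset Strict Implicit.
Unset Printing Implicit Defensive.
Local Open Scope nat_scope.

(** * Two counting principles for finite families *)

(** This is the Sauer-Shelah bound for VC dimension at most 1. Deleting a point [x] of [V] merges
    the members of [C] in pairs: the traces on [V :\ x] are counted by induction, and at most one
    trace comes from two members. *)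
Lemma card_le_no_shattered_pair (T : finType) (V : {set T}) (C : {set {set T}}) :
    (forall A, A \in C -> A \subset V) ->
    (forall i j, i \in V -> j \in V -> i != j -> exists a b : bool,
       forall A, A \in C -> (i \in A) = a -> (j \in A) = b -> False) ->
  #|C| <= #|V|.+1.
Proof.
have [k] := ubnP #|V|; elim: k V C => // k IH V C ltVk CV Cpair.
have [V0|[x xV]] := set_0Vmem V.
  have: C \subset [set set0].
    by apply/subsetP => A /CV; rewrite V0 subset0 inE.
  by move/subset_leq_card; rewrite cards1 => h; rewrite (leq_trans h).
pose C0 := [set A in C | x \notin A].
pose C1 := [set A in C | x \in A].
pose D1 := [set A :\ x | A in C1].
have cardD1 : #|D1| = #|C1|.
  apply: card_in_imset => A B; rewrite !inE => /andP[_ xA] /andP[_ xB] eqAB.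
  by rewrite -(setD1K xA) eqAB setD1K.
have cardC : #|C| = #|C0 :|: D1| + #|C0 :&: D1|.
  rewrite cardsUI cardD1 -(cardsID C1 C).
  have -> : C :&: C1 = C1.
    by apply/setP => A; rewrite !inE; case: (A \in C).
  have -> : C :\: C1 = C0; last by rewrite addnC.
  by apply/setP => A; rewrite !inE; case: (A \in C); rewrite ?andbT ?andbF.
have sub_lift A : A \in C0 :|: D1 ->
    exists2 B, B \in C & A = B :\ x.
  case/setUP => [|/imsetP[B]]; rewrite inE => /andP[AC xA].
    exists A => //; apply/setP => y; rewrite !inE; case: eqP => // ->.
    exact/negbTE.
  by move=> ->; exists B.
have cardVx : #|V| = #|V :\ x|.+1 by rewrite (cardsD1 x) xV.
have le1 : #|C0 :|: D1| <= #|V :\ x|.+1.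
  apply: IH => [|A /sub_lift[B BC ->]|i j].
  - by rewrite -ltnS -cardVx.
  - by apply: setSD; apply: CV.
  rewrite !inE => /andP[ix iV] /andP[jx jV] ij.
  have [a [b Cab]] := Cpair i j iV jV ij; exists a, b => A /sub_lift[B BC ->].
  by rewrite !inE ix jx /=; apply: Cab.
(* A set in [C0 :&: D1] lies in [C] both with and without [x]. Two such sets differing at [y] would
   realise all four patterns on [x] and [y]. *)
have le2 : #|C0 :&: D1| <= 1.
  have lift A : A \in C0 :&: D1 -> [/\ A \in C, x \notin A & x |: A \in C].
    rewrite inE => /andP[]; rewrite inE => /andP[AC xA] /imsetP[B].
    by rewrite inE => /andP[BC xB] eqA; rewrite eqA setD1K // -eqA; split.
  apply/card_le1_eqP => B A /lift[BC xB xBC] /lift[AC xA xAC].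
  apply/setP => y; apply/idP/idP => yA; apply: contraT => yB.
  - have yx : y != x by apply: contraTneq yA => ->.
    have [|a [b Cab]] := Cpair y x _ xV yx; first exact: (subsetP (CV _ AC)).
    have := (Cab _ AC, Cab _ BC, Cab _ xAC, Cab _ xBC).
    rewrite !inE eqxx (negbTE yx) /= yA (negbTE yB) (negbTE xA) (negbTE xB).
    by case: a {Cab}; case: b => -[[[]]] h1 h2 h3 h4; auto.
  - have yx : y != x by apply: contraTneq yA => ->.
    have [|a [b Cab]] := Cpair y x _ xV yx; first exact: (subsetP (CV _ BC)).
    have := (Cab _ AC, Cab _ BC, Cab _ xAC, Cab _ xBC).
    rewrite !inE eqxx (negbTE yx) /= yA (negbTE yB) (negbTE xA) (negbTE xB).
    by case: a {Cab}; case: b => -[[[]]] h1 h2 h3 h4; auto.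
by rewrite cardC cardVx -[leqRHS]addn1 leq_add.
Qed.

(** An element of [F] is revealed one coordinate at a time along [l], with at most [k] choices after
    each prefix. The induction splits [F] by the value at the head of [l]. *)
Lemma card_le_sequential (S I T : finType) (h : S -> I -> T) (F : {set S})
    (l : seq I) (k : nat) :
    (forall s t, s \in F -> t \in F -> {in l, h s =1 h t} -> s = t) ->
    (forall l1 x l2 s, l = l1 ++ x :: l2 -> s \in F ->
      #|[set h t x | t in F & all (fun y => h t y == h s y) l1]| <= k) ->
  #|F| <= k ^ size l.
Proof.
elim: l F => [|x l IH] F inj bound.
  by apply/card_le1_eqP => s t sF tF; apply: inj.
rewrite -sum1_card (partition_big_imset (h^~ x)) /=.
have [->|[s0 s0F]] := set_0Vmem F.
  by rewrite imset0 big_set0.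
have le_k : #|[set h s x | s in F]| <= k.
  apply: leq_trans (bound [::] x l s0 erefl s0F).
  apply: subset_leq_card; apply/subsetP => _ /imsetP[s sF ->].
  by apply: imset_f; rewrite inE sF.
apply: (@leq_trans (\sum_(t in [set h s x | s in F]) k ^ size l)); last first.
  by rewrite sum_nat_const /= expnS leq_mul2r le_k orbT.
apply: leq_sum => t _; rewrite sum1dep_card.
apply: IH => [s1 s2|l1 y l2 s eql].
  rewrite !inE => /andP[s1F /eqP s1x] /andP[s2F /eqP s2x] eqs.
  apply: inj => // z; rewrite inE => /predU1P[->|/eqs //].
  by rewrite s1x s2x.
rewrite inE => /andP[sF /eqP sx].
apply: leq_trans (bound (x :: l1) y l2 s _ sF); last by rewrite eql.
apply: subset_leq_card; apply/subsetP => _ /imsetP[u uP ->].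
move: uP; rewrite !inE => /andP[/andP[uF /eqP ux] uall].
by apply: imset_f; rewrite inE uF /= ux sx eqxx.
Qed.

(** * Two-dimensional faces and the upper bound for all USOs *)

Lemma in_symdiff n (A B : {set 'I_n}) j :
  (j \in symdiff A B) = (j \in A) (+) (j \in B).
Proof. by rewrite !inE; case: (j \in A); case: (j \in B). Qed.

Lemma orientation_flip n (s : outmap n) (v w : {set 'I_n}) j :
  is_orientation s -> w = symdiff v [set j] -> (j \in s w) = (j \notin s v).
Proof.
by move=> /forallP/(_ v)/forallP/(_ j)/eqP -> ->; rewrite negbK.
Qed.

(* If both pairs of parallel edges disagreed, antipodal vertices of the 2-face
   would have equal outmaps and the face would have zero or two sinks. *)
Lemma USO_parallel_edges n (s : outmap n) (v : {set 'I_n}) i j :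
    is_USO s -> i != j -> i \in v -> j \in v ->
    (i \in s v) = (i \notin s (v :\ j)) ->
    (j \in s v) = (j \notin s (v :\ i)) -> False.
Proof.
case/andP => ors /forallP/(_ [set i; j])/forallP/(_ v)/cards1P[u0 sink].
move=> ij iv jv par_i par_j.
have ji : j != i by rewrite eq_sym.
have step (w : {set 'I_n}) k : k \in w -> (k \in s (w :\ k)) = (k \notin s w).
  move=> kw; apply: orientation_flip => //; apply/setP => x.
  rewrite in_symdiff !inE; case: eqP => [->|_] /=; first by rewrite kw.
  by rewrite addbF.
have e1 := step v i iv; have e2 := step v j jv.
have e3 : (i \in s (v :\ i :\ j)) = (i \notin s (v :\ j)).
  have -> : v :\ i :\ j = v :\ j :\ i by apply/setP => x; rewrite !inE andbCA.
  by apply: step; rewrite !inE ij.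
have e4 : (j \in s (v :\ i :\ j)) = (j \notin s (v :\ i)).
  by apply: step; rewrite !inE ji.
have inface (w : {set 'I_n}) : (w == u0) = (w \in face [set i; j] v) &&
    ((i \notin s w) && (j \notin s w)).
  have := in_set1 w u0; rewrite -sink inE => <-; congr (_ && _).
  apply/eqP/andP => [/setP sw|[wi wj]].
    by split; [have := sw i|have := sw j]; rewrite !inE eqxx ?orbT andbT => ->.
  apply/setP => x; rewrite !inE; apply: contraNF wi => /andP[xs].
  case/orP => /eqP xE; first by rewrite -xE.
  by move: wj; rewrite -xE xs.
have facev (w : {set 'I_n}) : {in ~: [set i; j], w =i v} -> w \in face [set i; j] v.
  move=> wv; rewrite inE; apply/subsetP => x; apply: contraTT => xJ.
  by rewrite in_symdiff wv ?addbb // in_setC.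
have f0 : v \in face [set i; j] v by apply: facev.
have f1 : v :\ i \in face [set i; j] v.
  by apply: facev => x; rewrite !inE negb_or => /andP[->].
have f2 : v :\ j \in face [set i; j] v.
  by apply: facev => x; rewrite !inE negb_or => /andP[_ ->].
have f3 : v :\ i :\ j \in face [set i; j] v.
  by apply: facev => x; rewrite !inE negb_or => /andP[-> ->].
have u0E : [|| u0 == v, u0 == v :\ i, u0 == v :\ j | u0 == v :\ i :\ j].
  have := inface u0; rewrite eqxx => /esym/andP[+ _].
  rewrite inE => /subsetP u0v.
  have out x : x != i -> x != j -> (x \in u0) = (x \in v).
    move=> xi xj; have := u0v x; rewrite in_symdiff !inE (negbTE xi) (negbTE xj).
    by case: (x \in v); case: (x \in u0) => // /(_ isT).
  have eqs (w : {set 'I_n}) : (i \in u0) = (i \in w) -> (j \in u0) = (j \in w) ->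
      {in ~: [set i; j], w =i v} -> u0 == w.
    move=> hi hj hw; apply/eqP/setP => x.
    have [->//|xi] := eqVneq x i; have [->//|xj] := eqVneq x j.
    by rewrite out // hw // !inE negb_or xi.
  case ui : (i \in u0); case uj : (j \in u0).
  - by rewrite (eqs v) ?ui ?uj ?iv ?jv.
  - rewrite (eqs (v :\ j)) ?orbT // => [||x]; rewrite ?ui ?uj !inE ?ij ?eqxx ?iv //.
    by rewrite negb_or => /andP[_ ->].
  - rewrite (eqs (v :\ i)) ?orbT // => [||x]; rewrite ?ui ?uj !inE ?ji ?eqxx ?jv //.
    by rewrite negb_or => /andP[->].
  - rewrite (eqs (v :\ i :\ j)) ?orbT // => [||x]; rewrite ?ui ?uj !inE ?eqxx ?andbF //.
    by rewrite negb_or => /andP[-> ->].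
have := (inface v, inface (v :\ i), inface (v :\ j), inface (v :\ i :\ j)).
rewrite f0 f1 f2 f3 e1 e2 e3 e4 /=.
have -> : (i \in s (v :\ j)) = (i \notin s v) by rewrite par_i negbK.
have -> : (j \in s (v :\ i)) = (j \notin s v) by rewrite par_j negbK.
rewrite !negbK.
have vi : v != v :\ i :\ j.
  by apply: contraTneq iv => /setP/(_ i); rewrite !inE eqxx /= andbF => ->.
have vij : v :\ i != v :\ j.
  by apply: contraTneq iv => /setP/(_ i); rewrite !inE eqxx ij /= => <-.
move: u0E; rewrite ![u0 == _]eq_sym; move=> u0E [[[h0 h1] h2] h3].
move: h0 h1 h2 h3 u0E.
case: (i \in s v); case: (j \in s v) => /= h0 h1 h2 h3;
  rewrite h0 h1 h2 h3 // => _.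
  by move: h1 h2 vij => /eqP -> /eqP ->; rewrite eqxx.
by move: h0 h3 vi => /eqP -> /eqP ->; rewrite eqxx.
Qed.

Lemma card_USO_le n : #|[set s : outmap n | is_USO s]| <= n.+1 ^ 2 ^ n.
Proof.
pose leC (A B : {set 'I_n}) := #|A| <= #|B|.
pose l := sort leC (enum {set 'I_n}).
have meml x : x \in l by rewrite mem_sort mem_enum.
have sortl : sorted leC l by apply: sort_sorted => A B; apply: leq_total.
have -> : 2 ^ n = size l.
  by rewrite size_sort -cardE -cardsT -powersetT card_powerset cardsT card_ord.
apply: (card_le_sequential
  (h := fun (s : outmap n) (v : {set 'I_n}) => s v :&: v)).
  move=> s t; rewrite !inE => /andP[ors _] /andP[ort _] eqst.
  apply/ffunP => v; apply/setP => j.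
  have [jv|jv] := boolP (j \in v).
    by have /setP/(_ j) := eqst v (meml v); rewrite !inE jv !andbT.
  (* An upward edge at [v] is recorded as a downward edge at its other end. *)
  have /setP/(_ j) := eqst (symdiff v [set j]) (meml _).
  rewrite !inE eqxx (negbTE jv) /= !andbT.
  rewrite (orientation_flip ors erefl) (orientation_flip ort erefl).
  by move/negb_inj.
move=> l1 x l2 s eql; rewrite inE => sU.
have below (y : {set 'I_n}) : #|y| < #|x| -> y \in l1.
  move=> ltyx; have := meml y; rewrite eql mem_cat inE.
  case/orP => // /predU1P[yx|yl2]; first by rewrite yx ltnn in ltyx.
  have tr : transitive leC by move=> A B D; apply: leq_trans.
  move: sortl; rewrite eql => /cat_sorted2[_] /=; rewrite path_sortedE //.
  by case/andP => /allP/(_ y yl2); rewrite /leC leqNgt ltyx.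
have le_n : #|x| <= n by rewrite -[leqRHS]card_ord max_card.
apply: leq_trans (_ : #|x|.+1 <= _) => //.
apply: card_le_no_shattered_pair.
  by move=> _ /imsetP[t _ ->]; apply: subsetIr.
(* The excluded pattern disagrees with both parallel edges in the 2-face below [x]. Those edges
   belong to [x :\ j] and [x :\ i], which are smaller than [x] and hence in the prefix, where [t]
   agrees with [s]. *)
move=> i j ix jx ij; exists (i \notin s (x :\ j)), (j \notin s (x :\ i)).
move=> _ /imsetP[t + ->]; rewrite !inE => /andP[tU /allP tl1].
rewrite ix jx !andbT => hi hj.
have agree (y : {set 'I_n}) k : y \in l1 -> k \in y -> (k \in t y) = (k \in s y).
  by move=> /tl1/eqP/setP/(_ k); rewrite !inE => + ky; rewrite ky !andbT.
have ltD k : k \in x -> x :\ k \in l1.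
  by move=> kx; apply: below; rewrite [ltnRHS](cardsD1 k) kx.
apply: (USO_parallel_edges tU ij ix jx).
  by rewrite (agree (x :\ j)) ?ltD // !inE ij.
by rewrite (agree (x :\ i)) ?ltD // !inE eq_sym ij.
Qed.

(** * Counting independent sets in a graph of bounded degree *)

Definition independent_sets (T : finType) (X : {set T}) (R : rel T) (k : nat) :=
  [set M : {set T} | [&& M \subset X, #|M| == k &
    [forall e in M, forall e' in M, R e e' ==> (e == e')]]].

(** Double counting of the pairs of an independent [k]-set [M] and an element [e] extending it: [M]
    blocks at most [D * k] elements of [X], and an independent set of size [k.+1] arises from at
    most [k.+1] pairs. *)
Lemma card_independent_step (T : finType) (X : {set T}) (R : rel T) (D k : nat) :
    reflexive R -> symmetric R ->
    (forall e, e \in X -> #|[set e' in X | R e e']| <= D) ->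
  #|independent_sets X R k| * (#|X| - D * k) <= #|independent_sets X R k.+1| * k.+1.
Proof.
move=> Rrefl Rsym RD.
pose free (M : {set T}) := [set e in X | [forall e' in M, ~~ R e' e]].
have free_ge M : M \in independent_sets X R k -> #|X| - D * k <= #|free M|.
  rewrite inE => /and3P[/subsetP MX /eqP <- _].
  rewrite leq_subLR -(cardsID (free M) X) addnC.
  apply: leq_add; last by apply: subset_leq_card; apply: subsetIr.
  have sub : X :\: free M \subset \bigcup_(e in M) [set e' in X | R e e'].
    apply/subsetP => e; rewrite !inE => /andP[+ eX]; rewrite eX /=.
    rewrite negb_forall => /existsP[e']; rewrite negb_imply negbK => /andP[e'M Re].
    by apply/bigcupP; exists e'; rewrite // inE eX.
  apply: leq_trans (subset_leq_card sub) _.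
  apply: leq_trans (_ : \sum_(e in M) #|[set e' in X | R e e']| <= _).
    elim/big_rec2: _ => [|e m A _ IH]; first by rewrite cards0.
    by rewrite (leq_trans (leq_card_setU _ _)) // leq_add2l.
  rewrite mulnC -sum_nat_const; apply: leq_sum => e eM.
  exact: RD (MX e eM).
apply: (@leq_trans (\sum_(M in independent_sets X R k) #|free M|)).
  by rewrite -sum_nat_const; apply: leq_sum.
apply: (@leq_trans (\sum_(M in independent_sets X R k.+1) #|M|)); last first.
  rewrite -sum_nat_const; apply: leq_sum => M.
  by rewrite inE => /and3P[_ /eqP -> _].
have expand (S : {set {set T}}) (f : {set T} -> {set T}) :
    \sum_(M in S) #|f M| = \sum_e #|[set M in S | e \in f M]|.
  under eq_bigr => M _ do rewrite -sum1_card big_mkcond.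
  rewrite exchange_big; apply: eq_bigr => e _ /=.
  by rewrite -big_mkcondr sum1dep_card.
(* Both sums are regrouped by [e]; for fixed [e], the map from [M] to [e |: M] is injective on the
   sets that [e] extends. *)
rewrite expand (expand _ id); apply: leq_sum => e _.
have notin (M : {set T}) : e \in free M -> e \notin M.
  rewrite inE => /andP[_ /forallP/(_ e)].
  by rewrite Rrefl implybF.
rewrite -(card_in_imset (f := fun M => e |: M)); last first.
  move=> M N; rewrite !inE -!andbA => /and5P[_ _ _ eX eM] /and5P[_ _ _ _ eN] eqMN.
  have {}eM : e \notin M by apply: notin; rewrite inE eX.
  have {}eN : e \notin N by apply: notin; rewrite inE eX.
  by rewrite -(setU1K eM) eqMN setU1K.
apply: subset_leq_card; apply/subsetP => _ /imsetP[M + ->].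
rewrite inE => /andP[]; rewrite inE => /and3P[MX /eqP cM Mi] fe.
have eM := notin M fe; move: fe; rewrite inE => /andP[eX /forall_inP fe].
rewrite !inE eqxx andbT cardsU1 eM cM eqxx subUset sub1set eX MX /=.
apply/forall_inP => x xM; apply/forall_inP => y yM; apply/implyP => Rxy.
case/setU1P: xM => [xe|xM]; case/setU1P: yM => [ye|yM].
- by rewrite xe ye.
- by have := fe y yM; rewrite Rsym -xe Rxy.
- by have := fe x xM; rewrite -ye Rxy.
- exact: (implyP (forall_inP (forall_inP Mi x xM) y yM)).
Qed.

(** * Flipping a facet matching in the downward orientation *)

Section MatchingFlip.
Variables (n : nat) (l : 'I_n).

Implicit Types (v w : {set 'I_n}) (e : {set 'I_n} * 'I_n)
  (M : {set {set 'I_n} * 'I_n}).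

(* The edge between [v] and [j |: v], with [j \notin v], is encoded as [(v, j)]. *)
Definition edge_ends (e : {set 'I_n} * 'I_n) : {set {set 'I_n}} :=
  [set e.1; e.2 |: e.1].

Definition edges_touch : rel ({set 'I_n} * 'I_n) :=
  fun e e' => edge_ends e :&: edge_ends e' != set0.

Definition facet_edges : {set {set 'I_n} * 'I_n} :=
  [set e : {set 'I_n} * 'I_n | (l \in e.1) && (e.2 \notin e.1)].

Definition facet_matchings (k : nat) : {set {set {set 'I_n} * 'I_n}} :=
  independent_sets facet_edges edges_touch k.

(** The downward orientation has the identity as outmap. The pair [(v :\ j, j)] encodes the edge at
    [v] in direction [j], whichever end [v] is. *)
Definition flip_matching (M : {set {set 'I_n} * 'I_n}) : outmap n :=
  [ffun v => symdiff v [set j | (v :\ j, j) \in M]].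

Lemma in_flip M v j :
  (j \in flip_matching M v) = (j \in v) (+) ((v :\ j, j) \in M).
Proof. by rewrite ffunE in_symdiff inE. Qed.

Lemma edges_touch_refl : reflexive edges_touch.
Proof.
by move=> e; apply/set0Pn; exists e.1; rewrite setIid !inE eqxx.
Qed.

Lemma edges_touch_sym : symmetric edges_touch.
Proof. by move=> e e'; rewrite /edges_touch setIC. Qed.

Lemma mem_edge_ends (v : {set 'I_n}) j : v \in edge_ends (v :\ j, j).
Proof.
rewrite !inE /=; have [jv|jv] := boolP (j \in v).
  by rewrite setD1K // eqxx orbT.
by rewrite (setDidPl _) ?eqxx // disjoint_sym disjoints1.
Qed.

Lemma edge_of_end e v : e.2 \notin e.1 -> v \in edge_ends e -> e = (v :\ e.2, e.2).
Proof.
case: e => a j /= ja; rewrite !inE /= => /orP[]/eqP->.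
  by rewrite (setDidPl _) // disjoint_sym disjoints1.
by rewrite setU1K.
Qed.

(** A touching edge is determined by a shared end, one of two, and its direction, one of [n]. *)
Lemma facet_degree e : #|[set e' in facet_edges | edges_touch e e']| <= 2 * n.
Proof.
pose h (p : {set 'I_n} * 'I_n) := (p.1 :\ p.2, p.2).
apply: (@leq_trans #|h @: setX (edge_ends e) [set: 'I_n]|).
  apply: subset_leq_card; apply/subsetP => e'; rewrite !inE -andbA.
  case/and3P => _ e'2 /set0Pn[v /setIP[ve ve']].
  apply/imsetP; exists (v, e'.2); first by rewrite in_setX ve inE.
  exact: edge_of_end.
rewrite (leq_trans (leq_imset_card _ _)) // cardsX cardsT card_ord.
by rewrite leq_mul // cards2; case: (_ != _).
Qed.

Lemma card_facet_edges : (n - 1) * 2 ^ (n - 2) <= #|facet_edges|.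
Proof.
have -> : #|facet_edges| =
    \sum_j \sum_(v : {set 'I_n}) (if (l \in v) && (j \notin v) then 1 else 0).
  rewrite exchange_big pair_bigA -sum1_card big_mkcond.
  by apply: eq_bigr => e _; rewrite inE.
rewrite (bigD1 l) //=; apply: leq_trans (leq_addl _ _).
have -> : n - 1 = #|predC1 l| by rewrite cardC1 card_ord subn1.
rewrite -sum_nat_const; apply: leq_sum => j; rewrite inE => jl.
rewrite -big_mkcond sum1dep_card.
have <- : #|~: [set l; j]| = n - 2.
  by rewrite [#|~: _|]cardsCs setCK card_ord cards2 eq_sym jl.
have avoid w : w \in powerset (~: [set l; j]) -> (l \notin w) && (j \notin w).
  by rewrite powersetE subsetC subUset !sub1set !inE.
(* For [j] other than [l], adding [l] embeds the subsets of [~: [set l; j]] into the lower ends of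
   facet edges in direction [j]. *)
rewrite -card_powerset -(card_in_imset (f := fun w => l |: w)
    (D := powerset (~: [set l; j]))); last first.
  move=> v w /avoid/andP[lv _] /avoid/andP[lw _] eqvw.
  by rewrite -(setU1K lv) eqvw setU1K.
apply: subset_leq_card; apply/subsetP => _ /imsetP[w /avoid/andP[_ jw] ->].
by rewrite !inE eqxx negb_or jl.
Qed.

Lemma flip_unique k M v i j : M \in facet_matchings k ->
  (v :\ i, i) \in M -> (v :\ j, j) \in M -> i = j.
Proof.
rewrite inE => /and3P[_ _ /forall_inP Mi] iM jM.
have /implyP := forall_inP (Mi _ iM) _ jM.
have -> : edges_touch (v :\ i, i) (v :\ j, j).
  by apply/set0Pn; exists v; rewrite inE !mem_edge_ends.
by case/(_ isT)/eqP.
Qed.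

Lemma flip_orientation M : is_orientation (flip_matching M).
Proof.
apply/forallP => v; apply/forallP => j; rewrite !in_flip in_symdiff inE eqxx addbT.
have -> : symdiff v [set j] :\ j = v :\ j.
  apply/setP => x; rewrite inE in_symdiff !inE.
  by case: eqP => //= _; rewrite addbF.
by rewrite addNb negbK.
Qed.

(* Flips at [u] and [v] cancel all of [symdiff u v] only on a 2-face, where the
   two flipped edges would share a vertex. *)
Lemma flip_separates k M u v : M \in facet_matchings k -> u != v ->
  exists2 j, j \in symdiff u v &
    (j \in flip_matching M u) != (j \in flip_matching M v).
Proof.
move=> kM uv; apply/exists_inP; apply: contraT => /exists_inPn same.
(* If the edge at [x] in direction [j] is flipped, every other differing direction is flipped at
   [y], so there is exactly one, [i]. The flipped edges in directions [j] and [i] then meet at [w],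
   the neighbour of [x] along [j]. *)
have core x y j : j \in symdiff x y -> (x :\ j, j) \in M ->
    {in symdiff x y, forall i, ((x :\ i, i) \in M) = ((y :\ i, i) \notin M)} ->
    False.
  move=> jxy jM flip; pose w := symdiff x [set j].
  have wj : w :\ j = x :\ j.
    apply/setP => z; rewrite in_setD1 [in RHS]in_setD1 in_symdiff inE.
    by case: eqP => //= _; rewrite addbF.
  have [i ixy ij] : exists2 i, i \in symdiff x y & i != j.
    apply/exists_inP; apply: contraT => /exists_inPn only.
    have eqxy : x :\ j = y :\ j.
      apply/setP => z; rewrite !inE; case: eqP => //= /eqP zj.
      have := contraTN (only z) zj; rewrite in_symdiff.
      by case: (z \in x); case: (z \in y).
    by have := flip j jxy; rewrite -eqxy jM.
  have other z : z \in symdiff x y -> z != j -> (y :\ z, z) \in M.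
    move=> zxy; apply: contraNT; rewrite -flip // => zM.
    by apply/eqP; apply: flip_unique kM zM jM.
  have wi : w :\ i = y :\ i.
    apply/setP => z; rewrite in_setD1 [in RHS]in_setD1 in_symdiff inE.
    case: eqP => //= /eqP zi; have [->|zj] := eqVneq z j.
      by move: jxy; rewrite in_symdiff ?eqxx; case: (j \in x); case: (j \in y).
    rewrite addbF.
    have zxy : z \notin symdiff x y.
      apply: contraNN zi => zxy; apply/eqP.
      exact: flip_unique kM (other z zxy zj) (other i ixy ij).
    by move: zxy; rewrite in_symdiff; case: (z \in x); case: (z \in y).
  have eqij : i = j.
    by apply: (flip_unique (v := w) kM); rewrite ?wi ?wj ?other.
  by rewrite eqij eqxx in ij.
have flipE j : j \in symdiff u v ->
    ((u :\ j, j) \in M) = ((v :\ j, j) \notin M).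
  move=> jD; have := same j jD; rewrite negbK !in_flip; move: jD.
  rewrite in_symdiff; case: (j \in u); case: (j \in v) => //= _;
    by case: (_ \in M); case: (_ \in M).
have [j jD] : exists j, j \in symdiff u v.
  apply/set0Pn; apply: contraNneq uv => D0; apply/eqP/setP => z.
  have := in_set0 z; rewrite -D0 in_symdiff.
  by case: (z \in u); case: (z \in v).
have [jM|jM] := boolP ((u :\ j, j) \in M).
  by case: (core u v j jD jM flipE).
have symC : symdiff v u = symdiff u v by apply: setUC.
case: (core v u j); rewrite ?symC //; first by move: jM; rewrite flipE ?negbK.
by move=> i iD; rewrite flipE ?negbK.
Qed.

Lemma symdiffK (A B : {set 'I_n}) : symdiff A (symdiff A B) = B.
Proof. by apply/setP => j; rewrite !in_symdiff addKb. Qed.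

(** The Szabo-Welzl argument: since outmaps separate vertices inside every face, the outmap
    restricted to a face along [J] is injective into [powerset J], hence bijective by cardinality,
    and takes the value [set0] exactly once. *)
Lemma flip_USO k M : M \in facet_matchings k -> is_USO (flip_matching M).
Proof.
move=> kM; rewrite /is_USO flip_orientation /=.
set s := flip_matching M.
have sep u v (J : {set 'I_n}) : symdiff u v \subset J -> s u :&: J = s v :&: J -> u = v.
  move=> /subsetP uvJ /setP eqs; apply/eqP; apply: contraT => /(flip_separates kM).
  case=> j jJ; have := eqs j; rewrite !inE uvJ // !andbT => ->.
  by rewrite eqxx.
apply/forallP => J; apply/forallP => v.
pose g (w : {set 'I_n}) := s (symdiff v w) :&: J.
have gJ : g @: powerset J = powerset J.
  apply/eqP; rewrite eqEcard card_in_imset ?leqnn ?andbT.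
    by apply/subsetP => _ /imsetP[w _ ->]; rewrite inE subsetIr.
  move=> w w'; rewrite !inE => /subsetP wJ /subsetP w'J /sep eqv.
  rewrite -(symdiffK v w) eqv ?symdiffK //; apply/subsetP => j.
  rewrite !in_symdiff addbACA addbb /=.
  by case jw : (j \in w); case jw' : (j \in w') => // _; auto.
have : set0 \in g @: powerset J by rewrite gJ inE sub0set.
case/imsetP => w; rewrite inE => wJ /esym gw.
apply/cards1P; exists (symdiff v w); apply/setP => u; rewrite !inE.
apply/andP/eqP => [[uv /eqP su]|->]; last first.
  by rewrite symdiffK wJ -/(g w) gw.
apply: (sep _ _ J); last by rewrite su.
apply/subsetP => j; have := subsetP uv j; have := subsetP wJ j.
rewrite !in_symdiff; case: (j \in v); case: (j \in u); case: (j \in w); auto.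
Qed.

Lemma flip_off_facet k M w : M \in facet_matchings k -> l \notin w ->
  flip_matching M w = w.
Proof.
rewrite inE => /and3P[/subsetP MX _ _] lw; apply/setP => j.
rewrite in_flip; case jM : (_ \in M); last by rewrite addbF.
by have := MX _ jM; rewrite !inE (negbTE lw) andbF.
Qed.

(** Off the facet every edge points downwards, so a directed path only shrinks the vertex and never
    regains [l]. *)
Lemma reachmap_off_facet k M w : M \in facet_matchings k -> l \notin w ->
  reachmap (flip_matching M) w \subset w.
Proof.
move=> kM lw; rewrite /reachmap (flip_off_facet kM) // subUset subxx /=.
apply/bigcupsP => u /connectP[p]; elim: p w lw => [|x p IH] w lw /=.
  by move=> _ ->; rewrite (flip_off_facet kM).
case/andP => /existsP[j]; rewrite (flip_off_facet kM) // => /andP[jw /eqP xE] px uE.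
have xw : x \subset w.
  apply/subsetP => y; rewrite xE in_symdiff inE; case: eqP => [->|] //.
  by rewrite addbF.
apply: subset_trans (xw); apply: IH => //.
by apply: contra lw; apply: (subsetP xw).
Qed.

Lemma flip_nice k M : M \in facet_matchings k -> is_nice (flip_matching M) 1.
Proof.
move=> kM; set s := flip_matching M.
apply/forallP => v; apply/implyP; rewrite /is_global_sink => sv.
(* If [l] is in [v], take [j] to be [l]: no facet edge has direction [l], so that edge still points
   down. Otherwise any [j] in [v] works. Either way [j] is lost from the reachmap at [v :\ j]. *)
have [j js [jv lj]] : exists2 j, j \in s v & j \in v /\ l \notin v :\ j.
  have [lv|lv] := boolP (l \in v).
    exists l; last by rewrite !inE eqxx.
    rewrite in_flip lv; case lM : (_ \in M) => //.
    move: kM; rewrite inE => /and3P[/subsetP/(_ _ lM)].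
    by rewrite !inE eqxx.
  have sE := flip_off_facet kM lv; case/set0Pn: sv => j; rewrite /s sE => jv.
  by exists j => //; split=> //; rewrite !inE (negbTE lv) andbF.
have edge : dedge s v (v :\ j).
  apply/existsP; exists j; rewrite js /=; apply/eqP/setP => x.
  by rewrite in_symdiff !inE; case: eqP => [->|_]; rewrite ?jv ?addbF.
apply/existsP; exists (v :\ j); apply/andP; split.
  by apply/orP; right; apply/existsP; exists (v :\ j); rewrite edge /=.
apply/properP; split.
  apply/subsetP => x /setUP[xs|/bigcupP[w vw xs]]; apply/setUP; right;
    apply/bigcupP.
    by exists (v :\ j) => //; apply: connect1.
  by exists w => //; apply: connect_trans vw; apply: connect1.
exists j; first by rewrite inE js.
by apply/negP => /(subsetP (reachmap_off_facet kM lj)); rewrite !inE eqxx.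
Qed.

Lemma flip_inj k : {in facet_matchings k &, injective flip_matching}.
Proof.
move=> M N; rewrite !inE => /and3P[/subsetP MX _ _] /and3P[/subsetP NX _ _] eqs.
apply/setP => -[v j].
have [jv|jv] := boolP (j \in v).
  apply/idP/idP => [/MX|/NX]; rewrite inE /= jv andbF //.
have := in_flip M v j; rewrite eqs in_flip => /addbI.
by rewrite (setDidPl _) // disjoint_sym disjoints1.
Qed.

(** Each added edge gains a factor [n]. With [K = 2 ^ (n - 5)] there are at least [8 * (n - 1) * K]
    facet edges, while blocking and the division by [k.+1] require only [2 * n * k + n * k.+1], at
    most [3 * n * K] for [k < K]. *)
Lemma card_facet_matchings k :
  5 <= n -> k <= 2 ^ (n - 5) -> n ^ k <= #|facet_matchings k|.
Proof.
move=> n5; elim: k => [|k IH] ltk.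
  rewrite expn0 card_gt0; apply/set0Pn; exists set0.
  rewrite inE sub0set cards0 eqxx; apply/forall_inP => e.
  by rewrite inE.
have := card_independent_step k edges_touch_refl edges_touch_sym
  (fun e _ => facet_degree e); rewrite -/(facet_matchings _) => step.
rewrite expnS mulnC -(leq_pmul2r (ltn0Sn k)); apply: leq_trans step.
rewrite -mulnA leq_mul ?IH 1?ltnW //.
have := card_facet_edges.
have -> : n - 2 = (n - 5).+3 by lia.
rewrite !expnS; move: ltk.
move: (2 ^ _) (#|_|); nia.
Qed.

End MatchingFlip.

(** * Explicit bounds on the count and their asymptotic form *)

Lemma nice_USO_count_ge n : 5 <= n -> n ^ 2 ^ (n - 5) <= nice_USO_count n.
Proof.
move=> n5; have n0 : 0 < n by lia.
pose l := Ordinal n0.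
apply: leq_trans (card_facet_matchings l n5 (leqnn _)) _.
rewrite -(card_in_imset (@flip_inj n l _)).
apply: subset_leq_card; apply/subsetP => _ /imsetP[M kM ->].
by rewrite inE (flip_USO kM) (flip_nice kM).
Qed.

Lemma nice_USO_count_le n : 2 <= n -> nice_USO_count n <= n ^ (2 * 2 ^ n).
Proof.
move=> n2; apply: (@leq_trans (n.+1 ^ 2 ^ n)).
  apply: leq_trans (card_USO_le n); apply: subset_leq_card.
  by apply/subsetP => s; rewrite !inE => /andP[].
(* The base [n.+1] is at most [n ^ 2] once [n] is at least 2. *)
rewrite expnM leq_exp2r ?expn_gt0 //; nia.
Qed.

Lemma expn_pow (m k : nat) : m ^ k = Nat.pow m k.
Proof. by elim: k => // k IH; rewrite expnS IH. Qed.

Lemma nice_USO_count_lower n : le 5 n ->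
  le (Nat.pow n (Nat.pow 2 (Nat.sub n 5))) (nice_USO_count n).
Proof.
by move/leP => n5; apply/leP; rewrite -!expn_pow; apply: nice_USO_count_ge.
Qed.

Lemma nice_USO_count_upper n : le 5 n ->
  le (nice_USO_count n) (Nat.pow n (Nat.mul 2 (Nat.pow 2 n))).
Proof.
move/leP => n5; apply/leP; rewrite -!expn_pow.
by apply: nice_USO_count_le; apply: leq_trans n5.
Qed.

End Cube.

(* #{1-nice n-dim USOs} = n^{Theta(2^n)} *)
Theorem theorem10 :
  exists c1 c2 : R, 0 < c1 /\ 0 < c2 /\
  exists N : nat, forall n : nat, (N <= n)%nat ->
    Rpower (INR n) (c1 * INR (2 ^ n)) <= INR (nice_USO_count n) /\
    INR (nice_USO_count n) <= Rpower (INR n) (c2 * INR (2 ^ n)).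
Proof.
(* The constant [/ 32] turns [2 ^ n] into [2 ^ (n - 5)], and [2] comes from bounding [n.+1] by
   [n ^ 2]. *)
exists (/ 32), 2; split; [lra|split; [lra|]].
exists 5%nat; intros n n5.
assert (n_pos : 0 < INR n) by (apply lt_0_INR; lia).
assert (lower := nice_USO_count_lower n5).
assert (upper := nice_USO_count_upper n5).
apply le_INR in lower; apply le_INR in upper.
rewrite pow_INR, <- Rpower_pow in lower, upper by assumption.
replace (/ 32 * INR (2 ^ n)) with (INR (2 ^ (n - 5))).
2:{ replace n with (5 + (n - 5))%nat at 2 by lia.
    rewrite Nat.pow_add_r, mult_INR; simpl; field. }
rewrite mult_INR in upper; split; assumption.
Qed.
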